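(* Let $A$ and $B$ be linearly independent bounded linear operators acting on a complex Hilbert space $\mathscr{H}$ such that $\operatorname{rank}(A+\alpha_1B)>1$ and $\Re(\alpha_2A^*B)\ge 0$ for certain $\alpha_1,\alpha_2\in\mathbb{C}$, $\alpha_2\neq 0$. The following conditions are equivalent: (i) $A$ and $B$ are orthogonal in the Pythagoras sense. (ii) $A$ and $B$ verify the parallelogram law and there exists a sequence $(\xi_n)_{n\ge 0}$ of unit vectors in $\mathscr{H}$ such that, as $n\to\infty$, $\|A\xi_n\|\to\|A\|$, $\|B\xi_n\|\to\|B\|$ and $\langle A\xi_n,B\xi_n\rangle\to 0$. (iii) $A$ and $B$ verify the parallelogram law and there exists a sequence $(\xi_n)_{n\ge 0}$ of unit vectors in $\mathscr{H}$ such that $\|(A+\lambda B)\xi_n\|^2\to\|A\|^2+|\lambda|^2\|B\|^2$ as $n\to\infty$ for every $\lambda\in\mathbb{C}$.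
   Context: Norms of operators are operator norms. $A$ and $B$ are orthogonal in the Pythagoras sense if $\|A+\lambda B\|^2=\|A\|^2+|\lambda|^2\|B\|^2$ for every $\lambda\in\mathbb{C}$. $A$ and $B$ verify the parallelogram law if $\|A+\lambda B\|^2+\|A-\lambda B\|^2=2(\|A\|^2+|\lambda|^2\|B\|^2)$ for every $\lambda\in\mathbb{C}$. For a bounded operator $T$, $\Re(T)=\frac12(T+T^* )$, and $\operatorname{rank}(T)$ is the (possibly infinite) dimension of the range of $T$. *)

(* Defs.v *)
From HB Require Import structures.
From mathcomp Require Export all_boot all_order all_algebra sesquilinear.
From mathcomp Require Export complex.
From mathcomp Require Export all_classical all_reals all_analysis.
From mathcomp Require Import ring.
Export Order.TTheory GRing.Theory Num.Theory.
Export numFieldNormedType.Exports.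

Set Implicit Arguments.
Unset Strict Implicit.
Unset Printing Implicit Defensive.

Local Open Scope classical_set_scope.
Local Open Scope ring_scope.

(* Complex Hilbert spaces: the inner product is linear in its first argument
   and conjugate-linear in its second one, and it induces the complete norm. *)
HB.mixin Record CompleteNormedModule_isHilbert (R : realType) (H : Type)
    of CompleteNormedModule R[i] H := {
  inner : {dot H for Num.conj} ;
  inner_norm : forall x : H, inner x x = `|x| ^+ 2
}.

#[short(type="hilbertType")]
HB.structure Definition Hilbert (R : realType) :=
  { H of CompleteNormedModule R[i] H & CompleteNormedModule_isHilbert R H }.

Section Operators.
Variable R : realType.

(* Over R[i] the norm `|v| is an element of R[i] (with zero imaginary part);
   nrm v is the same number in R. *)
Definition nrm (V : normedZmodType R[i]) (v : V) : R := complex.Re `|v|.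

Definition lin_indep (n : nat) (V : lmodType R[i]) (v : 'I_n -> V) : Prop :=
  forall c : 'I_n -> R[i], \sum_i c i *: v i = 0 -> forall i, c i = 0.

Variable H : hilbertType R.
Implicit Types (S T : H -> H).

Definition bounded_operator T : Prop :=
  linear T /\ exists M : R, forall x : H, nrm (T x) <= M * nrm x.

Definition opnorm T : R := sup [set nrm (T x) | x in [set x : H | `|x| <= 1]].

(* For a bounded operator T, existence and uniqueness of the adjoint are
   adjointP and adjoint_unique below. *)
Definition adjoint T : H -> H :=
  get [set S | forall x y, inner (T x) y = inner x (S y)].

Definition re_part T : H -> H := 2^-1 *: (T + adjoint T).

(* In the order of R[i], 0 <= z means that z is real and nonnegative. *)
Definition nneg_operator T : Prop := forall x : H, 0 <= inner (T x) x.

(* Dimension of the range: the supremum of the sizes of its linearly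
   independent families, so that every infinite dimension is +oo. *)
Definition rank T : \bar R :=
  ereal_sup [set (n%:R)%:E | n in [set n : nat |
    exists v : 'I_n -> H, lin_indep v /\ (forall i, range T (v i))]].

Definition pythagoras S T : Prop := forall lambda : R[i],
  opnorm (S + lambda *: T) ^+ 2 =
  opnorm S ^+ 2 + nrm lambda ^+ 2 * opnorm T ^+ 2.

Definition parallelogram S T : Prop := forall lambda : R[i],
  opnorm (S + lambda *: T) ^+ 2 + opnorm (S - lambda *: T) ^+ 2 =
  2 * (opnorm S ^+ 2 + nrm lambda ^+ 2 * opnorm T ^+ 2).

End Operators.

Section Adjoint.
Variables (R : realType) (H : hilbertType R).

Lemma innerC (x y : H) : inner x y = (inner y x)^*%R.
Proof. by rewrite (hermC inner x y) expr0 mul1r. Qed.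

Lemma inner_variation (u k : H) (d e : R[i]) :
  (forall c, d <= inner (u + c *: k) (u + c *: k)) ->
  inner u u <= d + e -> `|inner u k| ^+ 2 <= e * inner k k.
Proof.
move=> dle ule; have [->|k0] := eqVneq k 0.
  by rewrite !linear0r normr0 expr0n ?mulr0 /=.
have K0 : 0 < inner k k by rewrite dnorm_gt0.
have := dle (- (inner u k / inner k k)).
rewrite dnormD dnormZ linearZr_LR /= normrN normrM normfV (gtr0_norm K0).
set w := inner u k; set K := inner k k in K0 *.
have KE : K^*%R = K by apply: CrealP; exact: gtr0_real.
have wE : (- (w / K))^*%R * w = - (`|w| ^+ 2 / K).
  rewrite rmorphN rmorphM fmorphV /= KE normCK mulNr; congr (- _).
  by rewrite mulrAC [_ * w]mulrC.
have rE : (`|w| ^+ 2 / K)^*%R = `|w| ^+ 2 / K.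
  by apply: CrealP; rewrite ger0_real// divr_ge0// ltW.
rewrite wE rmorphN /= rE => h.
have {h} h : d + `|w| ^+ 2 / K <= inner u u.
  rewrite -lerBrDr; apply: le_trans h _.
  have -> : (`|w| / K) ^+ 2 * K = `|w| ^+ 2 / K.
    by field; rewrite gt_eqF.
  by rewrite -addrA lerD2l addrA subrr sub0r.
rewrite -ler_pdivrMr// -(lerD2l d); exact: le_trans h ule.
Qed.

Lemma inner_re (x : H) : inner x x = (complex.Re (inner x x))%:C%C.
Proof.
have := dnorm_ge0 inner x; case: (inner x x) => a b.
by rewrite lecE /= => /andP[/eqP -> _].
Qed.

Lemma cauchy_schwarz (x y : H) : `|inner x y| <= `|x| * `|y|.
Proof.
rewrite -(@ler_pXn2r _ 2) ?nnegrE ?mulr_ge0// exprMn -!inner_norm.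
by apply: (@inner_variation _ _ 0); rewrite ?add0r// => c; exact: dnorm_ge0.
Qed.

Lemma parallelogram_law (x y : H) :
  inner (x - y) (x - y) = 2 * inner x x + 2 * inner y y - inner (x + y) (x + y).
Proof. by rewrite dnormB dnormD; ring. Qed.

Lemma natSinv_cplx (e : R[i]) : 0 < e ->
  \forall n \near \oo, (n.+1%:R^-1 : R)%:C%C < e.
Proof.
case: e => a b; rewrite ltcE /= => /andP[/eqP -> a0].
near=> n; rewrite ltcR; near: n.
exact: (near_infty_natSinv_lt (PosNum a0)).
Unshelve. all: by end_near. Qed.

Lemma riesz (f : {scalar H}) (M : R[i]) :
  (forall x, `|f x| <= M * `|x|) -> exists z, forall x, f x = inner x z.
Proof.
move=> fM; have [f0|/existsNP[x0 /eqP fx0]] := pselect (forall x, f x = 0).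
  by exists 0 => x; rewrite f0 linear0r.
pose C := `|M| + 1.
have C0 : 0 < C by rewrite ltr_wpDl.
have fC x : `|f x| <= C * `|x|.
  have := fM x; have [->|x0'] := eqVneq x 0.
    by rewrite linear0 !normr0 !mulr0.
  move=> h; apply: (le_trans h); rewrite ler_wpM2r//.
  have Mr : M \is Num.real.
    have : 0 <= M * `|x| by apply: le_trans h.
    by rewrite pmulr_lge0 ?normr_gt0// => /ger0_real.
  by rewrite (le_trans (real_ler_norm Mr))// lerDl.
pose D := [set complex.Re (inner x x) | x in [set x | f x = 1]].
have D_inf : has_inf D.
  split.
    exists (complex.Re (inner ((f x0)^-1 *: x0) ((f x0)^-1 *: x0))).
    by exists ((f x0)^-1 *: x0) => //=; rewrite linearZ/= mulVf.
  exists 0 => _ [x _ <-]; rewrite -lecR -inner_re; exact: dnorm_ge0.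
pose d : R[i] := (inf D)%:C%C.
have dle x : f x = 1 -> d <= inner x x.
  move=> fx; rewrite inner_re lecR; apply: ge_inf; first by case: D_inf.
  by exists x.
have /choice[u uP] : forall n : nat, exists x, f x = 1 /\
    inner x x <= d + (n.+1%:R^-1 : R)%:C%C.
  move=> n; have n0 : 0 < (n.+1%:R^-1 : R) by [].
  have [_ [x fx <-] xlt] := inf_adherent n0 D_inf.
  by exists x; split => //; rewrite inner_re -rmorphD lecR ltW.
have fu n : f (u n) = 1 by case: (uP n).
have ule n := (uP n).2.
have ucauchy n m : inner (u n - u m) (u n - u m) <=
    2 * (n.+1%:R^-1 : R)%:C%C + 2 * (m.+1%:R^-1 : R)%:C%C.
  rewrite parallelogram_law.
  have f1 : f (2^-1 *: (u n + u m)) = 1.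
    by rewrite linearZ/= linearD/= !fu; field.
  have := dle _ f1; rewrite dnormZ ger0_norm// => hd.
  have {}hd : 4 * d <= inner (u n + u m) (u n + u m).
    rewrite -ler_pdivlMl// mulrC; apply: (le_trans hd).
    by rewrite mulrC exprVn -natrX.
  rewrite lerBlDr; apply: le_trans
    (lerD (lerD (lexx _) (lexx _)) hd).
  have -> : 2 * (n.+1%:R^-1 : R)%:C%C + 2 * (m.+1%:R^-1 : R)%:C%C + 4 * d =
     2 * (d + (n.+1%:R^-1 : R)%:C%C) + 2 * (d + (m.+1%:R^-1 : R)%:C%C) by ring.
  by rewrite lerD// ler_pM2l.
have ucau : cauchy (u @ \oo).
  apply: cauchy_exP => e e0.
  have e20 : 0 < e ^+ 2 / 4 by rewrite divr_gt0// exprn_gt0.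
  have [N _ Nlt] := natSinv_cplx e20.
  exists (u N); exists N => // n /= Nn.
  rewrite -ball_normE /= -(@ltr_pXn2r _ 2) ?nnegrE ?(ltW e0)//.
  rewrite -inner_norm; apply: (le_lt_trans (ucauchy _ _)).
  have := Nlt N (leqnn _); have := Nlt n Nn => /= h1 h2.
  have -> : e ^+ 2 = 2 * (e ^+ 2 / 4) + 2 * (e ^+ 2 / 4) by field.
  by rewrite ltrD// ltr_pM2l.
have /cvg_ex[z /= uz0] : cvg (u @ \oo) by exact: cauchy_cvg.
have uz e : 0 < e -> \forall n \near \oo, `|z - u n| < e.
  by move=> e0; move/cvgrPdist_lt : uz0 => /(_ e e0).
have fz : f z = 1.
  apply/eqP; rewrite -subr_eq0 -normr_le0.
  rewrite real_leNgt ?normr_real//; apply/negP => fz0.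
  have [N _ /(_ N (leqnn _)) /= h] := uz _ (divr_gt0 fz0 C0).
  have := fC (z - u N); rewrite linearB/= fu => /le_lt_trans.
  move=> /(_ (C * (`|f z - 1| / C))); rewrite ltr_pM2l// => /(_ h).
  by rewrite mulrC divfK ?gt_eqF// ltxx.
have zk k : f k = 0 -> inner z k = 0.
  move=> fk; have [->|k0] := eqVneq k 0; first by rewrite linear0r.
  have K0 : 0 < `|k| by rewrite normr_gt0.
  apply/eqP; rewrite -normr_le0 real_leNgt ?normr_real//; apply/negP => t0.
  pose e := `|inner z k| / 2 / `|k|.
  have e0 : 0 < e by rewrite !divr_gt0.
  have [N [h1 h2]] : exists N, `|z - u N| < e /\ (N.+1%:R^-1 : R)%:C%C < e ^+ 2.
    have : \forall n \near \oo, `|z - u n| < e /\ (n.+1%:R^-1 : R)%:C%C < e ^+ 2.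
      by near=> n; split; near: n; [exact: uz|apply: natSinv_cplx; rewrite exprn_gt0].
    by move=> [N _ /(_ N (leqnn _)) h]; exists N.
  have ukN : `|inner (u N) k| < e * `|k|.
    rewrite -(@ltr_pXn2r _ 2) ?nnegrE ?mulr_ge0// ?(ltW e0)//.
    rewrite exprMn -inner_norm.
    apply: le_lt_trans (_ : (N.+1%:R^-1 : R)%:C%C * inner k k < _).
      apply: (inner_variation _ (ule N)) => c.
      by apply: dle; rewrite linearD/= linearZ/= fk mulr0 addr0.
    by rewrite ltr_pM2r// inner_norm exprn_gt0.
  have : `|inner z k| < e * `|k| + e * `|k|.
    rewrite -{1}(subrK (u N) z) linearDl.
    apply: (le_lt_trans (ler_normD _ _)); rewrite ltrD//.
    by rewrite (le_lt_trans (cauchy_schwarz _ _))// ltr_pM2r.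
  by rewrite divfK ?gt_eqF// -splitr ltxx.
have zz0 : inner z z != 0.
  rewrite dnorm_eq0; apply: contra_eq_neq fz => ->.
  by rewrite linear0 eq_sym oner_eq0.
exists ((inner z z)^-1 *: z) => x.
have : inner z (x - f x *: z) = 0.
  by apply: zk; rewrite linearB/= linearZ/= fz mulr1 subrr.
move=> h; have : inner (x - f x *: z) z = 0 by rewrite innerC h rmorph0.
rewrite linearBl linearZl_LR /= => /eqP; rewrite subr_eq0 => /eqP xz.
rewrite linearZr_LR /= xz fmorphV /= -innerC mulrC mulfK//.
Unshelve. all: by end_near. Qed.

Lemma adjointP (T : H -> H) : bounded_operator T ->
  forall x y, inner (T x) y = inner x (adjoint T y).
Proof.
move=> [Tlin [M TM]].
suff /choice[S ST] : forall y, exists z, forall x, inner (T x) y = inner x z.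
  have [S' S'T] : exists S', (forall x y, inner (T x) y = inner x (S' y)).
    by exists S => x y; exact: ST.
  by apply: (@getPex _ [set S | forall x y, inner (T x) y = inner x (S y)]);
    exists S'.
move=> y; pose f x := inner (T x) y.
have flin : scalar f by move=> a u v; rewrite /f Tlin linearPl.
pose fM := GRing.isLinear.Build _ _ _ _ f flin.
pose F : {scalar H} := HB.pack f fM.
apply: (@riesz F (M%:C%C * `|y|)) => x /=.
apply: (le_trans (cauchy_schwarz _ _)); rewrite mulrAC ler_wpM2r//.
have nrmE (v : H) : `|v| = (nrm v)%:C%C.
  by have := normr_ge0 v; rewrite /nrm; case: `|v| => a b;
    rewrite lecE /= => /andP[/eqP ->].
by rewrite !nrmE -rmorphM lecR.
Qed.

Lemma adjoint_unique (T S : H -> H) :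
  (forall x y, inner (T x) y = inner x (S y)) -> adjoint T = S.
Proof.
move=> TS; apply/funext => y.
have TA : forall x y, inner (T x) y = inner x (adjoint T y).
  by apply: (@getPex _ [set S | forall x y, inner (T x) y = inner x (S y)]);
    exists S.
apply/eqP; rewrite -subr_eq0 -(dnorm_eq0 inner).
by rewrite linearBr /= -TA -TS subrr.
Qed.

End Adjoint.

(* Main.v *)
(* Put K(x) = conj(alpha2) <Ax, Bx>.  The hypothesis says Re K >= 0, so
   F(x) = (|A|^2 |x|^2 - |Ax|^2) + |alpha2|^2 (|B|^2 |x|^2 - |Bx|^2) + 2 Re K(x)
   is a positive quadratic form.  The Pythagoras identity at
   lambda = - alpha2 (1 + i t), t small of either sign, gives unit vectors on
   which F is small and t Im K is almost nonpositive.  Two such vectors, for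
   opposite signs of t, span a plane on which F stays small; by the
   Toeplitz-Hausdorff argument it contains a vector with Im K = 0.  This is the
   maximizing sequence of (ii); everything else is expansion of
   |(A + lambda B) x|^2. *)

Require Import Defs.
From mathcomp Require Import ring lra.

Local Open Scope classical_set_scope.
Local Open Scope ring_scope.
Local Open Scope complex_scope.

(** * The real-valued norm and isotropic vectors of sesquilinear forms *)

Section HilbertNorm.
Set Implicit Arguments.
Unset Strict Implicit.
Variables (R : realType) (H : hilbertType R).
Implicit Types (x y z : H) (c : R[i]).

Lemma innerZl c x y : inner (c *: x) y = c * inner x y.
Proof. exact: (linearZl_LR (@inner R H)). Qed.

Lemma innerZr c x y : inner x (c *: y) = c^*%R * inner x y.
Proof. exact: (linearZr_LR (@inner R H)). Qed.

Lemma innerDl x y z : inner (x + y) z = inner x z + inner y z.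
Proof. exact: (linearDl (@inner R H)). Qed.

Lemma innerDr x y z : inner x (y + z) = inner x y + inner x z.
Proof. exact: (linearDr (@inner R H)). Qed.

(** Nonnegative elements of [R[i]] have zero imaginary part, so inequalities between norms can be
    moved to the real field, where [lra] and [nra] work. *)
Lemma nrmE (V : normedZmodType R[i]) (v : V) : `|v| = (nrm v)%:C.
Proof.
have := normr_ge0 v; rewrite /nrm; case: `|v| => a b.
by rewrite lecE /= => /andP[/eqP ->].
Qed.

Lemma nrm_ge0 (V : normedZmodType R[i]) (v : V) : 0 <= nrm v.
Proof. by have := normr_ge0 v; rewrite nrmE lecR. Qed.

Lemma nrmZ c x : nrm (c *: x) = nrm c * nrm x.
Proof. by rewrite /nrm normrZ !nrmE -rmorphM. Qed.

Lemma nrm_real (a : R) : nrm a%:C = `|a|.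
Proof. by rewrite /nrm /= expr0n addr0 sqrtr_sqr. Qed.

Lemma nrm_sqr x : nrm x ^+ 2 = complex.Re (inner x x).
Proof. by rewrite inner_norm nrmE -rmorphXn. Qed.

Lemma nrm_complex (z : R[i]) : nrm z ^+ 2 = complex.Re z ^+ 2 + complex.Im z ^+ 2.
Proof. by case: z => a b; rewrite /nrm /= sqr_sqrtr// addr_ge0// sqr_ge0. Qed.

Lemma nrm_sqrD x y :
  nrm (x + y) ^+ 2 = nrm x ^+ 2 + nrm y ^+ 2 + 2 * complex.Re (inner x y).
Proof.
rewrite !nrm_sqr dnormD /= !raddfD /=; congr (_ + _).
by case: (inner x y) => a b /=; rewrite mulr_natl mulr2n.
Qed.

(** The parallelogram law, solved for the difference so that rewriting with it eliminates
    [x - y]. *)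
Lemma nrm_sqrB x y :
  nrm (x - y) ^+ 2 = 2 * nrm x ^+ 2 + 2 * nrm y ^+ 2 - nrm (x + y) ^+ 2.
Proof.
rewrite !nrm_sqrD linearNr raddfN /=.
have -> : nrm (- y) = nrm y by rewrite /nrm normrN.
by ring.
Qed.

Lemma nrm_sqrDZ c x y : nrm (x + c *: y) ^+ 2 =
  nrm x ^+ 2 + nrm c ^+ 2 * nrm y ^+ 2 + 2 * complex.Re (c^*%R * inner x y).
Proof. by rewrite nrm_sqrD nrmZ exprMn innerZr. Qed.

Lemma nrm0 : nrm (0 : H) = 0.
Proof. by rewrite /nrm normr0. Qed.

Lemma nrm_gt0 x : x != 0 -> 0 < nrm x.
Proof. by rewrite -normr_gt0 nrmE ltcR. Qed.

Lemma nrm_eq1 x : (nrm x = 1) <-> (`|x| = 1).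
Proof. by rewrite nrmE; split => [->//|[]]. Qed.

Lemma nrm_normalize x : x != 0 -> nrm ((nrm x)^-1%:C *: x) = 1.
Proof.
move=> /nrm_gt0 x0; rewrite nrmZ nrm_real ger0_norm ?invr_ge0 ?(ltW x0)//.
by rewrite mulVf// gt_eqF.
Qed.

(* Among the vectors x + c y, the phase of c cancels the cross terms of the
   hermitian form Im K, its modulus balances Im K x x against Im K y y, and its
   sign keeps the norm of x + c y from degenerating. *)
Lemma isotropic_vector (F : H -> R) (K : H -> H -> R[i]) (d : R) x y :
    (forall u v w, K (u + v) w = K u w + K v w) ->
    (forall u v w, K u (v + w) = K u v + K u w) ->
    (forall c u v, K (c *: u) v = c * K u v) ->
    (forall c u v, K u (c *: v) = c^*%R * K u v) ->
    (forall u, 0 <= F u) ->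
    (forall u v, F (u + v) + F (u - v) = 2 * F u + 2 * F v) ->
    (forall c u, F (c *: u) = nrm c ^+ 2 * F u) -> 0 <= d ->
    F x <= d * nrm x ^+ 2 -> F y <= d * nrm y ^+ 2 ->
    0 < complex.Im (K x x) -> complex.Im (K y y) < 0 ->
  exists2 v, v != 0 & complex.Im (K v v) = 0 /\ F v <= 2 * d * nrm v ^+ 2.
Proof.
move=> KDl KDr KZl KZr F0 FD FZ d0 Fx Fy Kx Ky.
have KZ c u : complex.Im (K (c *: u) (c *: u)) = nrm c ^+ 2 * complex.Im (K u u).
  rewrite KZl KZr nrm_complex; case: c (K u u) => a b [r s] /=; ring.
(* For [c = u^*] the sum [K x (c y) + K (c y) x] equals [|K y x|^2 - |K x y|^2], which is real. If
   [u = 0], the two cross terms are conjugate already and [c = 1] works. *)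
have [c c0 Kc] : exists2 c : R[i], c != 0 &
    complex.Im (K x (c *: y) + K (c *: y) x) = 0.
  pose u := K y x - (K x y)^*%R.
  have [u0|u0] := eqVneq u 0.
    exists 1; rewrite ?oner_eq0// scale1r.
    move/eqP: u0; rewrite subr_eq0 => /eqP ->.
    by case: (K x y) => a b /=; ring.
  exists u^*%R; first by rewrite conjC_eq0.
  rewrite KZl KZr conjCK /u.
  by case: (K x y) (K y x) => a b [r s] /=; ring.
wlog Rc : c c0 Kc / 0 <= complex.Re (inner x (c *: y)).
  move=> wl; have [|Rc] := leP 0 (complex.Re (inner x (c *: y))); first exact: wl.
  apply: (wl (- c)); rewrite ?oppr_eq0//.
    by rewrite scaleNr -scaleN1r KZl KZr rmorphN1 -mulrDr mulN1r raddfN /= Kc oppr0.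
  by rewrite scaleNr linearNr raddfN /= oppr_ge0 ltW.
have nc : 0 < nrm c.
  by rewrite -ltcR -nrmE normr_gt0.
set e := c *: y in Kc Rc.
have Fe : F e <= d * nrm e ^+ 2.
  by rewrite FZ nrmZ exprMn mulrCA ler_pM2l ?exprn_gt0.
have Ke : complex.Im (K e e) < 0 by rewrite KZ pmulr_rlt0 ?exprn_gt0.
clearbody e.
pose q := complex.Im (K e e); have q0 : q < 0 by [].
pose p := complex.Im (K x x); have p0 : 0 < p by [].
(* These weights give [a^2 p + b^2 q = 0]. Being real, they multiply the cross terms by [a b], so
   the cancellation in [Kc] survives. *)
pose a := Num.sqrt (- q); pose b := Num.sqrt p.
have a2 : a ^+ 2 = - q by rewrite sqr_sqrtr// oppr_ge0 ltW.
have b2 : b ^+ 2 = p by rewrite sqr_sqrtr// ltW.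
have a0 : 0 <= a by exact: sqrtr_ge0.
have b0 : 0 <= b by exact: sqrtr_ge0.
pose v := a%:C *: x + b%:C *: e.
have ab : complex.Re (inner (a%:C *: x) (b%:C *: e)) =
    a * b * complex.Re (inner x e).
  rewrite innerZl innerZr; case: (inner x e) => r s /=; ring.
have nv : nrm v ^+ 2 = - q * nrm x ^+ 2 + p * nrm e ^+ 2
    + 2 * (a * b * complex.Re (inner x e)).
  by rewrite nrm_sqrD ab !nrmZ !nrm_real !ger0_norm// !exprMn a2 b2.
have x0 : 0 < nrm x ^+ 2.
  rewrite exprn_gt0// nrm_gt0//; apply: contraTneq p0 => x0.
  by rewrite /p x0 -(scale0r (0 : H)) KZl mul0r ltxx.
have Rab : 0 <= a * b * complex.Re (inner x e) by rewrite !mulr_ge0.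
have lev : - q * nrm x ^+ 2 + p * nrm e ^+ 2 <= nrm v ^+ 2.
  by rewrite nv lerDl mulr_ge0.
exists v.
  apply/eqP => v0; have := lev; rewrite v0 nrm0 expr0n /=.
  have : 0 < - q * nrm x ^+ 2 by rewrite mulr_gt0 ?oppr_gt0.
  have : 0 <= p * nrm e ^+ 2 by rewrite mulr_ge0 ?sqr_ge0 ?(ltW p0).
  by lra.
split.
  rewrite /v KDl !KDr addrACA [in X in _ + X]addrC.
  rewrite !raddfD /= -/v !KZ !nrm_real !ger0_norm// a2 b2 -/p -/q.
  move: Kc; rewrite !KZl !KZr; case: (K x e) (K e x) => r s [t w] /= Kc.
  suff -> : w = - s by ring.
  by apply/eqP; rewrite -addr_eq0 addrC Kc.
(* Parallelogram law for [F], dropping the nonnegative value at the difference; this is the source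
   of the factor 2 in the conclusion. *)
have Fv : F v <= 2 * (- q * F x) + 2 * (p * F e).
  rewrite -a2 -b2 (_ : a ^+ 2 * F x = F (a%:C *: x)); last first.
    by rewrite FZ nrm_real ger0_norm.
  rewrite (_ : b ^+ 2 * F e = F (b%:C *: e)); last first.
    by rewrite FZ nrm_real ger0_norm.
  by rewrite -FD lerDl.
apply: (le_trans Fv).
have h1 : - q * F x <= - q * (d * nrm x ^+ 2) by rewrite ler_pM2l// oppr_gt0.
have h2 : p * F e <= p * (d * nrm e ^+ 2) by rewrite ler_pM2l.
have := ler_wpM2l d0 lev; lra.
Qed.

End HilbertNorm.

(** * Limits of real and complex sequences *)

Section Limits.
Set Implicit Arguments.
Unset Strict Implicit.
Variable R : realType.

Lemma cvg_harmonic_bound (u : nat -> R) (l : R) :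
  (forall n, `|l - u n| <= n.+1%:R^-1) -> u @ \oo --> l.
Proof.
move=> ul; apply/cvgrPdist_lt => e e0; near=> n.
apply: (le_lt_trans (ul n)); near: n.
exact: (near_infty_natSinv_lt (PosNum e0)).
Unshelve. all: by end_near. Qed.

Lemma cvg_ext (u v : nat -> R) (l m : R) :
  u @ \oo --> l -> u =1 v -> l = m -> v @ \oo --> m.
Proof. by move=> + /funext uv lm; rewrite uv lm. Qed.

(** Condition (ii) speaks of norms while every expansion is in squared norms. The converse direction
    is continuity of the square root. *)
Lemma cvg_sqr (u : nat -> R) (l : R) : (forall n, 0 <= u n) -> 0 <= l ->
  (fun n => u n ^+ 2) @ \oo --> l ^+ 2 <-> u @ \oo --> l.
Proof.
move=> u0 l0; split => [h|h]; last first.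
  exact: (cvgM h h).
have uE : u = (fun n => Num.sqrt (u n ^+ 2)).
  by apply/funext => n; rewrite sqrtr_sqr ger0_norm.
rewrite uE -[l]ger0_norm// -sqrtr_sqr.
apply: continuous_cvg => //.
exact: sqrt_continuous.
Qed.

Lemma cvg_complex0 (h : nat -> R[i]) :
  (h : nat -> R[i]^o) @ \oo --> (0 : R[i]^o) <->
  (fun n => complex.Re (h n)) @ \oo --> 0 /\
  (fun n => complex.Im (h n)) @ \oo --> 0.
Proof.
(* The sum of the two squares is below [2 e^2]; the cruder bound [4 e^2] avoids a square root of
   2. *)
have ReIm z (e : R) : 0 < e ->
    `|complex.Re z| < e -> `|complex.Im z| < e -> nrm z ^+ 2 < (2 * e) ^+ 2.
  move=> e0; rewrite !ltr_norml nrm_complex => /andP[h1 h2] /andP[h3 h4].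
  by nra.
split=> [h0|[rh ih]].
  split; apply/cvgrPdist_lt => e e0;
    have /cvgrPdist_lt/(_ e%:C) := h0; rewrite ltcR => /(_ e0);
    apply: filterS => n; rewrite !sub0r !normrN nrmE ltcR => hn;
    apply: le_lt_trans hn; rewrite -ler_sqr ?nnegrE ?nrm_ge0//;
    by rewrite real_normK ?num_real// nrm_complex ?lerDl ?lerDr sqr_ge0.
apply/cvgrPdist_lt => -[e z]; rewrite ltcE /= => /andP[/eqP -> e0].
have e20 : 0 < e / 2 by rewrite divr_gt0.
move/cvgrPdist_lt : rh => /(_ _ e20) rh; move/cvgrPdist_lt : ih => /(_ _ e20) ih.
near=> n; rewrite sub0r normrN nrmE ltcR.
rewrite -ltr_sqr ?nnegrE ?nrm_ge0 ?(ltW e0)//.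
have -> : e = 2 * (e / 2) by field.
apply: ReIm => //.
  by rewrite -normrN -sub0r; near: n.
by rewrite -normrN -sub0r; near: n.
Unshelve. all: by end_near. Qed.

End Limits.

(** * Bounded operators and the operator norm *)

Section Operators.
Set Implicit Arguments.
Unset Strict Implicit.
Variables (R : realType) (H : hilbertType R).
Implicit Types (S T A B : H -> H).

Lemma bounded_operator_Dscale S T (c : R[i]) :
  bounded_operator S -> bounded_operator T -> bounded_operator (S + c *: T).
Proof.
move=> [Sl [M SM]] [Tl [N TN]]; split.
  move=> a u v; change (S (a *: u + v) + c *: T (a *: u + v) =
    a *: (S u + c *: T u) + (S v + c *: T v)).
  rewrite Sl Tl !scalerDr !scalerA [c * a]mulrC.
  by rewrite addrACA.
exists (M + nrm c * N) => x.
change (nrm (S x + c *: T x) <= (M + nrm c * N) * nrm x).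
have : nrm (S x + c *: T x) <= nrm (S x) + nrm c * nrm (T x).
  have := ler_normD (S x) (c *: T x).
  by rewrite !nrmE -rmorphD lecR nrmZ.
have := SM x; have := ler_wpM2l (nrm_ge0 c) (TN x); lra.
Qed.

Lemma bounded_operatorD T x y : bounded_operator T -> T (x + y) = T x + T y.
Proof. by move=> [Tl _]; rewrite -[x]scale1r Tl !scale1r. Qed.

Lemma bounded_operator0 T : bounded_operator T -> T 0 = 0.
Proof. by move=> /bounded_operatorD T0; apply: (addrI (T 0)); rewrite -T0 !addr0. Qed.

Lemma bounded_operatorZ T (c : R[i]) x : bounded_operator T -> T (c *: x) = c *: T x.
Proof.
by move=> Tb; have := Tb.1 c x 0; rewrite (bounded_operator0 Tb) !addr0.
Qed.

Lemma bounded_operatorB T x y : bounded_operator T -> T (x - y) = T x - T y.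
Proof.
by move=> Tb; rewrite bounded_operatorD// -scaleN1r bounded_operatorZ// scaleN1r.
Qed.

Lemma nrm_le_opnorm T x : bounded_operator T -> nrm (T x) <= opnorm T * nrm x.
Proof.
move=> Tb; have [_ [M TM]] := Tb.
have [->|x0] := eqVneq x 0; first by rewrite bounded_operator0// !nrm0 mulr0.
have nx := nrm_gt0 x0.
rewrite -ler_pdivrMr// mulrC.
have -> : (nrm x)^-1 * nrm (T x) = nrm (T ((nrm x)^-1%:C *: x)).
  by rewrite bounded_operatorZ// nrmZ nrm_real ger0_norm// invr_ge0 ltW.
apply: ub_le_sup; last first.
  by eexists => //=; rewrite nrmE nrm_normalize.
(* The absolute value spares a discussion of the sign of [M]. *)
exists `|M| => _ [y /= y1 <-]; apply: (le_trans (TM y)).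
have {}y1 : nrm y <= 1 by move: y1; rewrite nrmE lecR.
apply: (@le_trans _ _ (`|M| * nrm y)).
  by rewrite ler_wpM2r ?nrm_ge0// ler_norm.
by rewrite ler_piMr.
Qed.

Lemma opnorm_ge0 T : bounded_operator T -> 0 <= opnorm T.
Proof.
move=> Tb; have [[x x0]|] := pselect (exists x : H, x != 0).
  have := nrm_le_opnorm x Tb; have := nrm_ge0 (T x); have := nrm_gt0 x0.
  move=> x1 h1 h2; rewrite -(pmulr_lge0 _ x1); exact: le_trans h2.
(* In the zero space the supremum is taken over [[set 0]]. *)
move=> /forallNP H0; rewrite /opnorm.
suff -> : [set nrm (T x) | x in [set x : H | `|x| <= 1]] = [set 0] by rewrite sup1.
have xE (x : H) : x = 0 by have [//|/H0] := eqVneq x 0.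
apply/seteqP; split => [_ [x _ <-]|_ ->].
  by rewrite /= (xE x) (bounded_operator0 Tb) nrm0.
by exists 0; rewrite /= ?normr0 ?ler01// (bounded_operator0 Tb) nrm0.
Qed.

Lemma nrm_sqr_le_opnorm T x : bounded_operator T ->
  nrm (T x) ^+ 2 <= opnorm T ^+ 2 * nrm x ^+ 2.
Proof.
move=> Tb; rewrite -exprMn ler_sqr ?nnegrE ?mulr_ge0 ?nrm_ge0 ?opnorm_ge0//.
exact: nrm_le_opnorm.
Qed.

(** The supremum ranges over the unit ball, but unit vectors are wanted: if all of them stayed below
    [m], rescaling would bound [T] by the square root of [m] on the whole ball. *)
Lemma opnorm_approx T (x0 : H) (e : R) : bounded_operator T -> x0 != 0 ->
  0 < e -> exists2 x, nrm x = 1 & opnorm T ^+ 2 - e <= nrm (T x) ^+ 2.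
Proof.
move=> Tb x0_neq0 e0; apply: contrapT => /forall2NP noX.
pose m := opnorm T ^+ 2 - e.
have ltm x : nrm x = 1 -> nrm (T x) ^+ 2 < m.
  by move=> x1; case: (noX x) => [//|/negP]; rewrite -ltNge.
(* A large [e] could make [m] negative; the normalized [x0] excludes this under the assumption being
   refuted. *)
have m0 : 0 <= m.
  exact: ltW (le_lt_trans (sqr_ge0 _) (ltm _ (nrm_normalize x0_neq0))).
have : opnorm T <= Num.sqrt m.
  apply: ge_sup; first by exists (nrm (T 0)); exists 0; rewrite //= normr0 ler01.
  move=> _ [x /= x1 <-]; have {}x1 : nrm x <= 1 by move: x1; rewrite nrmE lecR.
  have [->|xn0] := eqVneq x 0; first by rewrite bounded_operator0// nrm0 sqrtr_ge0.
  have nx := nrm_gt0 xn0.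
  rewrite -ler_sqr ?nnegrE ?nrm_ge0 ?sqrtr_ge0// sqr_sqrtr//.
  have := ltW (ltm _ (nrm_normalize xn0)).
  rewrite bounded_operatorZ// nrmZ nrm_real ger0_norm ?invr_ge0 ?(ltW nx)// exprMn exprVn.
  rewrite ler_pdivrMl ?exprn_gt0// => /le_trans; apply.
  by rewrite ler_piMl// expr_le1// ltW.
rewrite -ler_sqr ?nnegrE ?opnorm_ge0 ?sqrtr_ge0// sqr_sqrtr// /m; lra.
Qed.

End Operators.

(** * From the Pythagoras identity to nearly maximizing vectors *)

Section Pythagoras.
Set Implicit Arguments.
Unset Strict Implicit.
Variables (R : realType) (H : hilbertType R).
Implicit Types (A B : H -> H) (alpha : R[i]).

(** The adjoint of [alpha A^* B] is [conj(alpha) B^* A], so the quadratic form of the real part at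
    [x] is the real part of [alpha <Bx, Ax>], which conjugation leaves unchanged. *)
Lemma nneg_re_partP A B alpha :
  bounded_operator A -> bounded_operator B ->
  nneg_operator (re_part (alpha *: (adjoint A \o B))) ->
  forall x, 0 <= complex.Re (alpha^*%R * inner (A x) (B x)).
Proof.
move=> Ab Bb; rewrite /nneg_operator /re_part.
have -> : adjoint (alpha *: (adjoint A \o B)) =
    alpha^*%R *: (adjoint B \o A).
  apply: adjoint_unique => x y.
  change (inner (alpha *: adjoint A (B x)) y =
    inner x (alpha^*%R *: adjoint B (A y))).
  by rewrite innerZl innerZr conjCK innerC -adjointP// -innerC adjointP.
move=> + x => /(_ x).
pose h : R[i] := 2^-1; have h0 : 0 < h by rewrite invr_gt0.
change (0 <= inner (h *: (alpha *: adjoint A (B x) +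
    alpha^*%R *: adjoint B (A x))) x ->
  0 <= complex.Re (alpha^*%R * inner (A x) (B x))).
rewrite (innerZl h) pmulr_rge0// innerDl (innerZl alpha) (innerZl alpha^*%R).
rewrite [inner (adjoint A _) x]innerC [inner (adjoint B _) x]innerC.
rewrite -!adjointP// -(innerC (A x)).
case: alpha (inner (A x) (B x)) => a b [r s]; rewrite lecE /= => /andP[_]; lra.
Qed.

(** Quantitative core of (i) implies (ii). Once [F] and [Im K] are small at a unit vector, the
    nonnegative summands [P], [a2 Q] and [2 Re K] of [F] are small separately. *)
Lemma pythagoras_near_maximal A B alpha (x0 : H) (e : R) :
    bounded_operator A -> bounded_operator B -> alpha != 0 -> x0 != 0 ->
    (forall x, 0 <= complex.Re (alpha^*%R * inner (A x) (B x))) ->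
    pythagoras A B -> 0 < e ->
  exists2 x, nrm x = 1 &
    [/\ opnorm A ^+ 2 - nrm (A x) ^+ 2 <= e,
        opnorm B ^+ 2 - nrm (B x) ^+ 2 <= e &
        nrm (inner (A x) (B x)) <= e].
Proof.
move=> Ab Bb alpha0 x0_neq0 K0 pyth e0.
pose a2 := nrm alpha ^+ 2.
have a20 : 0 < a2 by rewrite exprn_gt0// -ltcR -nrmE normr_gt0.
pose K x y := alpha^*%R * inner (A x) (B y).
pose P x := opnorm A ^+ 2 * nrm x ^+ 2 - nrm (A x) ^+ 2.
pose Q x := opnorm B ^+ 2 * nrm x ^+ 2 - nrm (B x) ^+ 2.
pose F x := P x + a2 * Q x + 2 * complex.Re (K x x).
pose g x := complex.Im (K x x).
have P0 x : 0 <= P x by rewrite subr_ge0 nrm_sqr_le_opnorm.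
have Q0 x : 0 <= a2 * Q x by rewrite mulr_ge0 ?(ltW a20)// subr_ge0 nrm_sqr_le_opnorm.
have {}K0 x : 0 <= complex.Re (K x x) by exact: K0.
have KDl u v w : K (u + v) w = K u w + K v w.
  by rewrite /K bounded_operatorD// innerDl mulrDr.
have KDr u v w : K u (v + w) = K u v + K u w.
  by rewrite /K bounded_operatorD// innerDr mulrDr.
have KZl c u v : K (c *: u) v = c * K u v.
  by rewrite /K bounded_operatorZ// innerZl mulrCA.
have KZr c u v : K u (c *: v) = c^*%R * K u v.
  by rewrite /K bounded_operatorZ// innerZr mulrCA.
have FD u v : F (u + v) + F (u - v) = 2 * F u + 2 * F v.
  (* Put in the same shape as [nrm_sqrB], so that all three summands of [F] lose their difference
     terms together. *)
  have KB : complex.Re (K (u - v) (u - v)) =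
      2 * complex.Re (K u u) + 2 * complex.Re (K v v)
      - complex.Re (K (u + v) (u + v)).
    rewrite -(scaleN1r v) !(KDl, KDr, KZl, KZr) rmorphN1 !mulN1r opprK.
    by rewrite !raddfD /= !raddfN /=; ring.
  rewrite /F /P /Q KB !(bounded_operatorB _ _ Ab, bounded_operatorB _ _ Bb).
  rewrite !(bounded_operatorD _ _ Ab, bounded_operatorD _ _ Bb).
  by rewrite !nrm_sqrB; ring.
have FZ c u : F (c *: u) = nrm c ^+ 2 * F u.
  have -> : F (c *: u) = nrm c ^+ 2 * (P u + a2 * Q u) +
      2 * complex.Re (K (c *: u) (c *: u)).
    by rewrite /F /P /Q !(bounded_operatorZ _ _ Ab, bounded_operatorZ _ _ Bb) !nrmZ; ring.
  rewrite KZl KZr /F nrm_complex.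
  by case: c (K u u) => r s [t w] /=; ring.
pose C := nrm alpha * opnorm A * opnorm B.
have C0 : 0 <= C by rewrite !mulr_ge0 ?nrm_ge0 ?opnorm_ge0.
have gC x : nrm x = 1 -> `|g x| <= C.
  move=> x1; apply: (@le_trans _ _ (nrm (K x x))).
    rewrite -ler_sqr ?nnegrE ?nrm_ge0// real_normK ?num_real// nrm_complex.
    by rewrite lerDr sqr_ge0.
  have -> : nrm (K x x) = nrm alpha * nrm (inner (A x) (B x)).
    by rewrite /nrm normrM norm_conjC !nrmE -rmorphM.
  rewrite /C -mulrA ler_wpM2l ?nrm_ge0//.
  have := cauchy_schwarz (A x) (B x); rewrite !nrmE -rmorphM lecR.
  move=> /le_trans; apply; apply: ler_pM; rewrite ?nrm_ge0//.
    by have := nrm_le_opnorm x Ab; rewrite x1 mulr1.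
  by have := nrm_le_opnorm x Bb; rewrite x1 mulr1.
(* At [lambda = - alpha (1 + i t)] the defect in the Pythagoras identity is
   [F + t^2 a2 Q + 2 t g], so near-maximality forces [t g] to be almost
   nonpositive while [F] is small. *)
have tilt t : t != 0 -> exists2 x, nrm x = 1 & F x + 2 * t * g x <= t ^+ 2.
  move=> t0; pose l : R[i] := - (alpha * (1 +i* t)).
  have t20 : 0 < t ^+ 2 by rewrite exprn_even_gt0.
  have [x x1 xP] := opnorm_approx (bounded_operator_Dscale l Ab Bb) x0_neq0 t20.
  exists x => //; move: xP.
  rewrite pyth (_ : (A + l *: B)%R x = A x + l *: B x)// nrm_sqrDZ.
  have -> : nrm l ^+ 2 = a2 * (1 + t ^+ 2).
    by rewrite /l /a2 !nrm_complex; case: (alpha) => r s /=; ring.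
  have -> : complex.Re (l^*%R * inner (A x) (B x)) =
      - (complex.Re (K x x) + t * g x).
    by rewrite /l /g /K; case: (alpha) (inner (A x) (B x)) => r s [u v] /=; ring.
  have := Q0 x; rewrite /F /P /Q x1 => Q1.
  have := mulr_ge0 (ltW t20) Q1; lra.
have small (d : R) : 0 < d -> exists2 x, nrm x = 1 & F x <= d /\ `|g x| <= d.
  (* This [t] satisfies [t <= 1] and [t (1 + 2 C) <= d / 2], hence [F <= t^2 + 2 t C <= d / 2] at
     the vectors given by [tilt]. *)
  move=> d0; pose t := d / (2 * (1 + 2 * C) + d).
  have den : 0 < 2 * (1 + 2 * C) + d by lra.
  have t0 : 0 < t by rewrite divr_gt0.
  have tE : t * (2 * (1 + 2 * C) + d) = d by rewrite divfK ?gt_eqF.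
  have t1 : t <= 1 by rewrite ler_pdivrMr// mul1r; lra.
  have tC : 0 <= t * C by rewrite mulr_ge0 ?(ltW t0).
  have td : 0 <= t * d by rewrite mulr_ge0 ?(ltW t0)// ltW.
  have tt : t ^+ 2 <= t by rewrite expr2 ler_piMl// ltW.
  have F0 x : 0 <= F x by have := P0 x; have := Q0 x; have := K0 x; rewrite /F; lra.
  have Fd x s : nrm x = 1 -> `|s| = t -> F x + 2 * s * g x <= s ^+ 2 ->
      F x <= d / 2.
    move=> x1 st; have : `|s * g x| <= t * C.
      by rewrite normrM st ler_wpM2l ?(ltW t0) ?gC.
    have : s ^+ 2 = t ^+ 2 by rewrite -st real_normK ?num_real.
    rewrite ler_norml => s2 /andP[h1 h2]; lra.
  have [x x1 xP] := tilt t (lt0r_neq0 t0).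
  have tn0 : - t != 0 by rewrite oppr_eq0 lt0r_neq0.
  have [y y1 yP] := tilt (- t) tn0.
  have Fx : F x <= d / 2 by apply: (Fd x t); rewrite // ger0_norm// ltW.
  have Fy : F y <= d / 2 by apply: (Fd y (- t)); rewrite // normrN ger0_norm// ltW.
  (* As [F] is nonnegative, the tilts by [t] and [- t] force [2 g x <= t] and [- 2 g y <= t]. *)
  have gx : g x <= d.
    have := F0 x => Fx0; have : t * (2 * g x) <= t * t by lra.
    rewrite ler_pM2l//; lra.
  have gy : - d <= g y.
    have := F0 y => Fy0; have : t * - (2 * g y) <= t * t by lra.
    rewrite ler_pM2l//; lra.
  have [gx0|gx0] := leP 0 (g x).
    by exists x => //; split; [lra|rewrite ger0_norm].
  have [gy0|gy0] := leP (g y) 0.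
    by exists y => //; split; [lra|rewrite ler_norml gy (le_trans gy0)// ltW].
  (* Here [g x < 0 < g y], so neither vector need serve alone. An isotropic combination has [g = 0],
     and the loss of a factor 2 turns [d / 2] into [d]. *)
  have d20 : 0 <= d / 2 by lra.
  have [v v0 [gv Fv]] : exists2 v, v != 0 &
      complex.Im (K v v) = 0 /\ F v <= 2 * (d / 2) * nrm v ^+ 2.
    by apply: (@isotropic_vector _ _ F K (d / 2) y x) => //;
      rewrite ?x1 ?y1 expr1n mulr1.
  have nv := nrm_gt0 v0.
  exists ((nrm v)^-1%:C *: v); first exact: nrm_normalize.
  rewrite FZ /g KZl KZr nrm_real real_normK ?num_real// exprVn.
  rewrite ler_pdivrMl ?exprn_gt0//; split; first lra.
  move: gv; case: (K v v) => r s /= ->.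
  by rewrite !(mulr0, mul0r, addr0, oppr0) normr0 ltW.
(* Chosen so that [t <= 1] and [2 t <= a2]: the first controls [P], the second [a2 Q], and both
   together give [|K|^2 <= 2 (t e)^2 <= a2 e^2]. *)
pose t := a2 / (2 * (1 + a2)).
have den : 0 < 2 * (1 + a2) by lra.
have t0 : 0 < t by rewrite divr_gt0.
have tE : t * (2 * (1 + a2)) = a2 by rewrite divfK ?gt_eqF.
have ta : 0 < t * a2 by rewrite mulr_gt0.
have t1 : t <= 1 by rewrite ler_pdivrMr// mul1r; lra.
have [x x1 [Fx gx]] := small (t * e) (mulr_gt0 t0 e0).
have := P0 x; have := Q0 x; have := K0 x.
have te : t * e <= e by rewrite ler_piMl// ltW.
rewrite /F in Fx => K1 Q1 P1; exists x => //; split.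
- by have : P x <= e by [lra]; rewrite /P x1 expr1n mulr1.
- have : a2 * Q x <= a2 * e.
    apply: (@le_trans _ _ (t * e)); first lra.
    by rewrite ler_pM2r//; lra.
  by rewrite ler_pM2l// /Q x1 expr1n mulr1.
- rewrite -ler_sqr ?nnegrE ?nrm_ge0 ?(ltW e0)// -(ler_pM2l a20).
  have -> : a2 * nrm (inner (A x) (B x)) ^+ 2 = nrm (K x x) ^+ 2.
    by rewrite /a2 -exprMn; congr (_ ^+ 2); rewrite /nrm normrM norm_conjC !nrmE -rmorphM.
  rewrite nrm_complex; apply: (@le_trans _ _ (2 * (t * e) ^+ 2)).
    have : complex.Re (K x x) ^+ 2 <= (t * e) ^+ 2.
      by rewrite ler_sqr ?nnegrE//; [lra|rewrite mulr_ge0// ltW].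
    have : g x ^+ 2 <= (t * e) ^+ 2.
      rewrite -(real_normK (num_real (g x))) ler_sqr ?nnegrE//.
      by rewrite mulr_ge0// ltW.
    rewrite /g; lra.
  rewrite exprMn mulrA ler_pM2r ?exprn_gt0//.
  have : t * t <= t by rewrite ler_piMl// ltW.
  rewrite expr2; lra.
Qed.

End Pythagoras.

(** * The equivalence of the three conditions *)

Theorem theorem4p12 (R : realType) (H : hilbertType R) (A B : H -> H)
  (alpha1 alpha2 : R[i])
  (A_bounded : bounded_operator A) (B_bounded : bounded_operator B)
  (AB_indep : lin_indep (tnth [tuple A; B]))
  (AB_rank : (1 < rank (A + alpha1 *: B)%R)%E)
  (alpha2_neq0 : alpha2 != 0)
  (AB_re : nneg_operator (re_part (alpha2 *: (adjoint A \o B)))) :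
  let i := pythagoras A B in
  let ii := parallelogram A B /\
    exists xi : nat -> H, (forall n, `|xi n| = 1) /\
      [/\ (fun n => nrm (A (xi n))) @ \oo --> opnorm A,
          (fun n => nrm (B (xi n))) @ \oo --> opnorm B &
          (fun n => inner (A (xi n)) (B (xi n)) : R[i]^o) @ \oo --> (0 : R[i]^o)] in
  let iii := parallelogram A B /\
    exists xi : nat -> H, (forall n, `|xi n| = 1) /\
      forall lambda : R[i],
        (fun n => nrm ((A + lambda *: B) (xi n)) ^+ 2) @ \oo
          --> opnorm A ^+ 2 + nrm lambda ^+ 2 * opnorm B ^+ 2 in
  (i <-> ii) /\ (ii <-> iii).
Proof.
move=> i ii iii.
(* In the zero space [A + B = 0], a nontrivial linear relation. *)
have [x0 x0_neq0] : exists x : H, x != 0.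
  apply: contrapT => /forallNP H0.
  have xE (x : H) : x = 0 by have [//|/H0] := eqVneq x 0.
  have : (1 : R[i]) = 0.
    apply: (AB_indep (fun=> 1) _ ord0).
    by apply/funext => x; rewrite [LHS]xE [RHS]xE.
  by apply/eqP; rewrite oner_eq0.
have expand (xi : nat -> H) (c : R[i]) n : nrm ((A + c *: B) (xi n)) ^+ 2 =
    nrm (A (xi n)) ^+ 2 + nrm c ^+ 2 * nrm (B (xi n)) ^+ 2 +
    2 * (complex.Re c * complex.Re (inner (A (xi n)) (B (xi n))) +
         complex.Im c * complex.Im (inner (A (xi n)) (B (xi n)))).
  rewrite (_ : (A + c *: B) (xi n) = A (xi n) + c *: B (xi n))// nrm_sqrDZ.
  by case: c (inner (A (xi n)) (B (xi n))) => a b [r s] /=; ring.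
have cvgA (xi : nat -> H) T : bounded_operator T ->
    (fun n => nrm (T (xi n)) ^+ 2) @ \oo --> opnorm T ^+ 2 <->
    (fun n => nrm (T (xi n))) @ \oo --> opnorm T.
  by move=> Tb; apply: cvg_sqr => [n|]; rewrite ?nrm_ge0 ?opnorm_ge0.
have ii_iii : ii -> iii.
  move=> [par [xi [xi1 [xiA xiB /cvg_complex0[xiR xiI]]]]]; split => //.
  exists xi; split => // c.
  under eq_fun do rewrite expand.
  move/(cvgA xi _ A_bounded) : xiA => xiA.
  move/(cvgA xi _ B_bounded) : xiB => xiB.
  rewrite (_ : _ + _ = opnorm A ^+ 2 + nrm c ^+ 2 * opnorm B ^+ 2 +
    2 * (complex.Re c * 0 + complex.Im c * 0)); last by ring.
  apply: cvgD; first by apply: cvgD => //; exact: cvgMl_tmp.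
  by apply: cvgMl_tmp; apply: cvgD; exact: cvgMl_tmp.
have iii_ii : iii -> ii.
  move=> [par [xi [xi1 xic]]]; split => //.
  (* Polarization: the values at [lambda = 0, 1, -1, i, -i] determine both squared norms and the two
     parts of the inner product as fixed linear combinations. *)
  pose f (r s : R) n := nrm ((A + (r +i* s) *: B) (xi n)) ^+ 2.
  have fE r s n : f r s n = nrm (A (xi n)) ^+ 2 +
      (r ^+ 2 + s ^+ 2) * nrm (B (xi n)) ^+ 2 +
      2 * (r * complex.Re (inner (A (xi n)) (B (xi n))) +
           s * complex.Im (inner (A (xi n)) (B (xi n)))).
    by rewrite /f expand nrm_complex.
  have cf r s : f r s @ \oo -->
      opnorm A ^+ 2 + (r ^+ 2 + s ^+ 2) * opnorm B ^+ 2.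
    by have := xic (r +i* s); rewrite nrm_complex.
  exists xi; split => //; split.
  - apply/cvgA => //; apply: (cvg_ext (cf 0 0)) => [n|]; rewrite ?fE; ring.
  - apply/cvgA => //.
    apply: (cvg_ext (u := fun n => 2^-1 * (f 1 0 n + f (-1) 0 n) - f 0 0 n)).
    + apply: cvgB; last exact: cf.
      by apply: cvgMl_tmp; apply: cvgD; exact: cf.
    + by move=> n; rewrite !fE; field.
    + by field.
  - apply/cvg_complex0; split.
      apply: (cvg_ext (u := fun n => 4^-1 * (f 1 0 n - f (-1) 0 n))).
      + by apply: cvgMl_tmp; apply: cvgB; exact: cf.
      + by move=> n; rewrite !fE; field.
      + by field.
    apply: (cvg_ext (u := fun n => 4^-1 * (f 0 1 n - f 0 (-1) n))).
    + by apply: cvgMl_tmp; apply: cvgB; exact: cf.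
    + by move=> n; rewrite !fE; field.
    + by field.
split; last by split.
split=> [pyth|/[dup] iiP /ii_iii[par [xi [xi1 xic]]]].
  split.
    move=> c; rewrite pyth (_ : A - c *: B = A + (- c) *: B); last by rewrite scaleNr.
    by rewrite pyth /nrm normrN; ring.
  have K0 := nneg_re_partP A_bounded B_bounded AB_re.
  have /choice[xi xiP] : forall n : nat, exists x : H, `|x| = 1 /\
    [/\ opnorm A ^+ 2 - nrm (A x) ^+ 2 <= n.+1%:R^-1,
        opnorm B ^+ 2 - nrm (B x) ^+ 2 <= n.+1%:R^-1 &
        nrm (inner (A x) (B x)) <= n.+1%:R^-1].
    move=> n; have n0 : 0 < (n.+1%:R^-1 : R) by [].
    have [x x1 xP] := pythagoras_near_maximal A_bounded B_bounded alpha2_neq0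
      x0_neq0 K0 pyth n0.
    by exists x; split => //; exact/nrm_eq1.
  exists xi; split; first by move=> n; case: (xiP n).
  have defect T n : bounded_operator T -> 0 <= opnorm T ^+ 2 - nrm (T (xi n)) ^+ 2.
    move=> Tb; have := nrm_sqr_le_opnorm (xi n) Tb.
    by rewrite ((nrm_eq1 (xi n)).2 (xiP n).1) expr1n mulr1 subr_ge0.
  split.
  - apply/cvgA => //; apply: cvg_harmonic_bound => n.
    by rewrite ger0_norm ?defect//; case: (xiP n) => _ [].
  - apply/cvgA => //; apply: cvg_harmonic_bound => n.
    by rewrite ger0_norm ?defect//; case: (xiP n) => _ [].
  - apply/cvg_complex0; split; apply: cvg_harmonic_bound => n;
      rewrite sub0r normrN; have [_ [_ _]] := xiP n; apply: le_trans;
      rewrite -ler_sqr ?nnegrE ?nrm_ge0// real_normK ?num_real//;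
      by rewrite nrm_complex ?lerDl ?lerDr sqr_ge0.
(* Along [xi] the norm of [A + c B] is at least the Pythagorean value. The parallelogram law says
   that the bounds at [c] and [- c] are attained in sum, so each is an equality. *)
have lower c : opnorm A ^+ 2 + nrm c ^+ 2 * opnorm B ^+ 2 <= opnorm (A + c *: B) ^+ 2.
  have Cb := bounded_operator_Dscale c A_bounded B_bounded.
  apply: (cvgr_to_le (xic c)); apply: nearW => n.
  have := nrm_sqr_le_opnorm (xi n) Cb.
  by rewrite ((nrm_eq1 (xi n)).2 (xi1 n)) expr1n mulr1.
move=> c; have := par c; have := lower c; have := lower (- c).
rewrite scaleNr (_ : nrm (- c) = nrm c); last by rewrite /nrm normrN.
lra.
Qed.
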